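(* Let $n\geq 1$ be an integer and let $W$ be a mean zero random variable with finite, non-zero variance $\sigma^2$. Then there exists a random variable $W^{*(n)}$, unique in distribution, such that for all $f\in C^n(\mathbb{R})$ for which the relevant expectations exist we have $$\mathbb{E}Wf(W)=\sigma^2\,\mathbb{E}A_nf(W^{*(n)}).$$
   Context: $T$ denotes the operator $Tf(x)=xf'(x)$, and $A_nf(x)=x^{-1}T^nf(x)=\frac{\mathrm{d}}{\mathrm{d}x}\big(T^{n-1}f(x)\big)$, where $T^k$ is the $k$-fold iterate of $T$. $C^n(\mathbb{R})$ denotes the $n$ times continuously differentiable functions on $\mathbb{R}$. *)

(* Defs.v *)
From HB Require Import structures.
From mathcomp Require Import all_boot all_order all_algebra.
From mathcomp Require Import all_classical all_reals all_analysis.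

Set Implicit Arguments.
Unset Strict Implicit.
Unset Printing Implicit Defensive.

Import Order.TTheory GRing.Theory Num.Theory.
Import numFieldNormedType.Exports.

Local Open Scope classical_set_scope.
Local Open Scope ring_scope.

Definition Cn (R : realType) (n : nat) (f : R -> R) : Prop :=
  (forall k : nat, (k < n)%N -> forall x : R, derivable (derive1n k f) x 1) /\
  continuous (derive1n n f).

Definition opT (R : realType) (f : R -> R) : R -> R := fun x => x * derive1 f x.

(* The second of the two expressions $x^{-1}T^nf(x) = (T^{n-1}f)'(x)$ is taken as
   the definition, because the first one is only meaningful for x != 0
   (in MathComp 0^-1 = 0). *)
Definition opA (R : realType) (n : nat) (f : R -> R) : R -> R :=
  derive1 (iter n.-1 (@opT R) f).

Lemma opAE (R : realType) (n : nat) (f : R -> R) (x : R) :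
  (1 <= n)%N -> x != 0 -> opA n f x = x^-1 * iter n (@opT R) f x.
Proof. by case: n => // n _ x0; rewrite /opA /= [in RHS]/opT mulKf. Qed.

(* W' has the W-zero bias distribution of order n. "The relevant expectations
   exist" is read as integrability of both W f(W) and A_n f(W'). *)
Definition zero_bias (R : realType) (n : nat) (sigma : R)
    (d : measure_display) (T : measurableType d) (P : probability T R)
    (W : {RV P >-> R})
    (d' : measure_display) (T' : measurableType d') (P' : probability T' R)
    (W' : {RV P' >-> R}) : Prop :=
  forall f : R -> R, Cn n f ->
    P.-integrable setT (EFin \o (fun t => W t * f (W t))) ->
    P'.-integrable setT (EFin \o (fun t => opA n f (W' t))) ->
    ('E_P[(fun t => W t * f (W t))%R] =
      (sigma ^+ 2)%:E * 'E_P'[fun t => opA n f (W' t)])%E.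

(* Main.v *)
Require Import Defs.
From HB Require Import structures.
From mathcomp Require Import all_boot all_order all_algebra.
From mathcomp Require Import all_classical all_reals all_analysis.
From mathcomp Require Import measurable_realfun.
From mathcomp Require Import ring lra.

(** Write S g (x) for the integral of g (u x) over u in [0, 1], the mean of g
    over the segment from 0 to x.  It inverts the operators of the statement:
    integrating the derivative of u |-> h (u x) or of u |-> u h (u x) over
    [0, 1] gives
      x S (f') (x) = f x - f 0    and    S ((x h)') = h,
    so that S maps A_(k+1) f to A_k f for k >= 1 and, in the end,
      x S^n (A_n f) (x) = f x - f 0.
    Conversely (x S g)' = g when g is smooth, so that f := x S^n g satisfies
    A_n f = g.

    Existence ([exists_zero_bias]).  If U is uniform on [0, 1] and independent
    of Y, Fubini gives E g (U Y) = E (S g) (Y).  Start from W under the measure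
    Q of density W^2 / sigma^2 with respect to P and multiply n times by
    independent uniform variables; the result W' satisfies
      sigma^2 E (A_n f) (W') = E (W^2 (S^n A_n f) (W)) = E (W (f W - f 0)),
    and E W = 0 removes the term f 0.

    Uniqueness.  When g is bounded with bounded derivatives, so is S^n g:
    differentiating under the integral turns S into its weighted analogue with
    the kernel u^j.  Hence f := x S^n g is an admissible test function, with
    |W f (W)| at most a constant times W^2, and the defining identity
    prescribes E g (W'') ([zero_bias_forces_mean]).  Sigmoids are such
    functions, because every derivative of a sigmoid is a polynomial in it.
    Steeper and steeper sigmoids converge to the indicator of a half-line, so
    the law of W'' is prescribed on half-lines, hence everywhere
    ([eq_distribution]). *)

Set Implicit Arguments.
Unset Strict Implicit.
Unset Printing Implicit Defensive.

Import Order.TTheory GRing.Theory Num.Theory.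
Import numFieldNormedType.Exports.

Local Open Scope classical_set_scope.
Local Open Scope ring_scope.

Local Notation leb := lebesgue_measure.

(** * Functions of class C^n *)

Lemma derivable1_continuous (R : realType) (f : R -> R) :
  (forall x, derivable f x 1) -> continuous f.
Proof. by move=> df x; exact/differentiable_continuous/derivable1_diffP. Qed.

Lemma is_derive1_derive1 (R : realType) (f : R -> R) (x : R) :
  derivable f x 1 -> is_derive x 1 f (derive1 f x).
Proof. by move=> df; apply: DeriveDef => //; rewrite derive1E. Qed.

Lemma CnS (R : realType) (n : nat) (f : R -> R) :
  Cn n.+1 f <-> (forall x, derivable f x 1) /\ Cn n (derive1 f).
Proof.
have iterE k : derive1n k.+1 f = derive1n k (derive1 f) by rewrite /derive1n iterSr.
split=> [[df cf]|[df [dfn cfn]]].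
  split; first exact: (df 0%N).
  by split=> [k kn|]; rewrite -iterE //; exact: df.
split=> [[_|k kn]|]; [exact: df|rewrite iterE; exact: dfn|by rewrite iterE].
Qed.

Lemma Cn_continuous (R : realType) (n : nat) (f : R -> R) : Cn n f -> continuous f.
Proof. by case: n => [[]//|n /CnS[df _]]; exact: derivable1_continuous. Qed.

Lemma CnW (R : realType) (n : nat) (f : R -> R) : Cn n.+1 f -> Cn n f.
Proof.
elim: n f => [|n IH] f /CnS[df cf]; last by apply/CnS; split=> //; exact: IH.
by split=> //; exact: derivable1_continuous.
Qed.

Lemma CnD (R : realType) (n : nat) (f g : R -> R) :
  Cn n f -> Cn n g -> Cn n (fun x => f x + g x).
Proof.
elim: n f g => [|n IH] f g.
  move=> [_ cf] [_ cg]; split=> // x; exact: continuousD (cf x) (cg x).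
move=> /CnS[df cf] /CnS[dg cg]; apply/CnS; split=> [x|]; first exact: derivableD.
suff -> : derive1 (fun x => f x + g x) = fun x => derive1 f x + derive1 g x.
  exact: IH.
by apply/funext => x; rewrite !derive1E deriveD.
Qed.

Lemma is_derive_mulx (R : realType) (f : R -> R) (x df : R) :
  is_derive x 1 f df -> is_derive x 1 (fun y => y * f y) (f x + x * df).
Proof.
move=> fx; apply: is_derive_eq; rewrite addrC.
by rewrite /GRing.scale/= mulr1.
Qed.

Lemma Cn_mulx (R : realType) (n : nat) (f : R -> R) :
  Cn n f -> Cn n (fun x => x * f x).
Proof.
elim: n f => [|n IH] f.
  by move=> [_ cf]; split=> // x; apply: continuousM => //; exact: cf.
move=> Cf; have /CnS[df cf] := Cf; apply/CnS.
have dx (x : R) : is_derive x 1 (fun y => y * f y) (f x + x * derive1 f x).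
  exact/is_derive_mulx/is_derive1_derive1.
split=> [x|]; first by case: (dx x).
suff -> : derive1 (fun x => x * f x) = fun x => f x + x * derive1 f x.
  by apply: CnD; [exact: CnW|exact: IH].
by apply/funext => x; rewrite derive1E; have [_ ->] := dx x.
Qed.

Lemma Cn_opT (R : realType) (n : nat) (f : R -> R) : Cn n.+1 f -> Cn n (opT f).
Proof. by move=> /CnS[_ cf]; exact: Cn_mulx. Qed.

Lemma Cn_iter_opT (R : realType) (n k : nat) (f : R -> R) :
  Cn (n + k) f -> Cn n (iter k (@opT R) f).
Proof.
elim: k n => [|k IH] n; first by rewrite addn0.
by rewrite -addSnnS => /IH/Cn_opT.
Qed.


(** * Weighted means over the segment from 0 to x *)

Lemma FTC01 (R : realType) (F f : R -> R) :
  (forall u : R, is_derive u 1 F (f u)) -> continuous f ->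
  \int[leb]_(u in `[0, 1]) f u = F 1 - F 0.
Proof.
move=> dF cf.
have cF : continuous F.
  by apply: derivable1_continuous => x; case: (dF x).
rewrite /Rintegral (@continuous_FTC2 R f F 0 1)//.
- exact: continuous_subspaceT.
- split=> [x _|//|//].
  + by case: (dF x).
  + exact: cvg_at_right_filter (cF 0).
  + exact: cvg_at_left_filter (cF 1).
- by move=> x _; rewrite derive1E; have [_ ->] := dF x.
Qed.

(** The exponent j = 0 gives the operator S of the introduction; the other
    exponents appear when S is differentiated. *)
Definition dilation_mean (R : realType) (j : nat) (g : R -> R) (x : R) : R :=
  \int[leb]_(u in `[0, 1]) (u ^+ j * g (u * x)).

Lemma continuous_dilation (R : realType) (j : nat) (g : R -> R) (x : R) :
  continuous g -> continuous (fun u : R => u ^+ j * g (u * x)).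
Proof.
move=> cg u.
apply: (@continuousM R R (fun u => u ^+ j) (fun u => g (u * x))).
  exact: exprn_continuous.
by apply: continuous_comp; [exact: mulrr_continuous|exact: cg].
Qed.

Lemma integrable01 (R : realType) (f : R -> R) :
  continuous f -> (leb : {measure set _ -> \bar R}).-integrable `[0, 1] (EFin \o f).
Proof.
move=> cf; apply: continuous_compact_integrable; first exact: segment_compact.
exact: continuous_subspaceT.
Qed.

Lemma is_derive_dilation (R : realType) (g : R -> R) (x u : R) :
  (forall x, derivable g x 1) ->
  is_derive u 1 (fun v : R => g (v * x)) (x * derive1 g (u * x)).
Proof.
move=> dg; rewrite mulrC.
apply: (@is_derive1_comp R g (fun v : R => v * x)).
  exact: is_derive1_derive1.
by apply: is_derive_eq; rewrite /GRing.scale/= mulr1 mulr0 add0r.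
Qed.

Lemma Rintegral01_cst (R : realType) (c : R) : \int[leb]_(u in (`[0, 1] : set R)) c = c.
Proof.
have d (u : R) : is_derive u 1 (fun u : R => u * c) c.
  by apply: is_derive_eq; rewrite /GRing.scale/= mulr1 mulr0 add0r.
by rewrite (FTC01 d) ?mul1r ?mul0r ?subr0//; exact: cst_continuous.
Qed.

Lemma norm_exprM_le (R : realType) (j : nat) (u y M : R) :
  0 <= u <= 1 -> `|y| <= M -> `|u ^+ j * y| <= M.
Proof.
move=> /andP[u0 u1] yM; rewrite normrM normrX (ger0_norm u0) -[M]mul1r.
by rewrite ler_pM// ?exprn_ge0// exprn_ile1.
Qed.

(** The domination required for continuity is only local: g may be unbounded, but
    near x it is evaluated on a compact segment. *)
Lemma dilation_mean_continuous (R : realType) (j : nat) (g : R -> R) :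
  continuous g -> continuous (dilation_mean j g).
Proof.
move=> cg x.
have [M gM] : exists M, forall y, `|y| <= `|x| + 1 -> `|g y| <= M.
  have le : - (`|x| + 1) <= `|x| + 1 by have := normr_ge0 x; lra.
  have cN : continuous (fun y => `|g y|).
    by move=> y; apply: continuous_comp (cg y) _; exact: norm_continuous.
  have [c _ cM] := EVT_max le (continuous_subspaceT cN).
  by exists `|g c| => y; rewrite ler_norml => yI; apply: cM; rewrite in_itv.
apply: (@continuity_under_integral R _ _ leb
    (fun x u => u ^+ j * g (u * x)) `[0, 1]%classic _ (x - 1) (x + 1) _ _ (cst M)) => //.
- by move=> y _; apply: integrable01; exact: continuous_dilation.
- apply: aeW => u _ y _; apply: (@continuousM R R (cst (u ^+ j)) (fun y => g (u * y))).
    exact: cst_continuous.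
  by apply: continuous_comp; [exact: mulrl_continuous|exact: cg].
- by apply: integrable01; exact: cst_continuous.
- move=> y /=; rewrite in_itv/= => /andP[y1 y2]; apply: aeW => u /=.
  rewrite in_itv/= => u01; have /andP[u0 u1] := u01; apply: norm_exprM_le => //.
  apply: gM; rewrite normrM (ger0_norm u0) -[leRHS]mul1r ler_pM//.
  by have := ler_norm x; have := ler_norm (- x); rewrite normrN ler_norml; lra.
- by rewrite inE/= in_itv/=; lra.
Qed.

Lemma dilation_mean_bound (R : realType) (j : nat) (g : R -> R) (M : R) :
  continuous g -> (forall x, `|g x| <= M) -> forall x, `|dilation_mean j g x| <= M.
Proof.
move=> cg gM x.
have ci := continuous_dilation (j := j) (x := x) cg.
apply: (le_trans (le_normr_Rintegral _ _)) => //; first exact: integrable01.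
rewrite -[leRHS]Rintegral01_cst; apply: le_Rintegral => //.
- apply: (@integrable01 R (fun u : R => `|u ^+ j * g (u * x)|)) => u.
  by apply: continuous_comp (ci u) _; exact: norm_continuous.
- by apply: (@integrable01 R (cst M)); exact: cst_continuous.
by move=> u /=; rewrite in_itv/= => u01; exact: norm_exprM_le.
Qed.

(** Differentiation under the integral: each derivative brings out one more
    factor u. *)
Lemma is_derive_dilation_mean (R : realType) (j : nat) (g : R -> R) (M : R) :
  (forall x, derivable g x 1) -> continuous (derive1 g) ->
  (forall x, `|derive1 g x| <= M) ->
  forall x : R, is_derive x 1 (dilation_mean j g) (dilation_mean j.+1 (derive1 g) x).
Proof.
move=> dg cg' g'M x.
have cg : continuous g := derivable1_continuous dg.
have M0 : 0 <= M by exact: le_trans (g'M 0).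
pose f (x u : R) := u ^+ j * g (u * x).
have df (y u : R) : is_derive y 1 (f ^~ u) (u ^+ j.+1 * derive1 g (u * y)).
  rewrite (_ : f ^~ u = (fun y => u ^+ j * g (y * u))); last first.
    by apply/funext => z; rewrite /f (mulrC z).
  have := is_derive_dilation u y dg => H; apply: is_derive_eq.
  by rewrite /GRing.scale/= mulrA -exprSr (mulrC y).
have d1f (y u : R) : partial1of2 f y u = u ^+ j.+1 * derive1 g (u * y).
  by rewrite partial1of2E; have [_ ->] := df y u.
have xI : `]x - 1, x + 1[%classic x by rewrite /= in_itv/=; lra.
have int_f y : `]x - 1, x + 1[%classic y -> leb.-integrable `[0, 1]%classic (EFin \o f y).
  by move=> _; apply: integrable01; exact: continuous_dilation.
have der y u : `]x - 1, x + 1[%classic y -> `[0, 1]%classic u -> derivable (f ^~ u) y 1.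
  by move=> _ _; case: (df y u).
have intM : leb.-integrable `[0, 1]%classic (EFin \o cst M).
  by apply: (@integrable01 R (cst M)); exact: cst_continuous.
have ub y u : `]x - 1, x + 1[%classic y -> `[0, 1]%classic u ->
    `|partial1of2 f y u| <= cst M u.
  by move=> _ /=; rewrite in_itv/= d1f => u01; exact: norm_exprM_le.
have m01 : measurable (`[0, 1]%classic : set (measurableTypeR R)) by [].
apply: DeriveDef.
  exact: (derivable_under_integral m01 xI int_f der (fun=> M0) intM ub).
rewrite -derive1E
  [LHS](differentiation_under_integral m01 xI int_f der (fun=> M0) intM ub).
by apply: eq_Rintegral => u _; rewrite d1f.
Qed.

(** The integrand of the left-hand side, x f' (u x), is the derivative of
    u |-> f (u x). *)
Lemma dilation_mean_derive1 (R : realType) (f : R -> R) (x : R) :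
  (forall x, derivable f x 1) -> continuous (derive1 f) ->
  x * dilation_mean 0 (derive1 f) x = f x - f 0.
Proof.
move=> df cf'.
have cd := continuous_dilation (j := 0) (x := x) cf'.
rewrite /dilation_mean -RintegralZl//; last exact: integrable01.
have -> : f x - f 0 = f (1 * x) - f (0 * x) by rewrite mul1r mul0r.
apply: (@FTC01 R (fun u => f (u * x))).
  by move=> u; rewrite expr0 mul1r; exact: is_derive_dilation.
move=> u; apply: (@continuousM R R (cst x) (fun u => u ^+ 0 * derive1 f (u * x))).
  exact: cst_continuous.
exact: cd.
Qed.

(** S inverts h |-> (x h)', because the integrand h (u x) + u x h' (u x) is the
    derivative of u |-> u h (u x).  Stating this without dividing by x covers
    x = 0. *)
Lemma dilation_mean_mulx (R : realType) (h : R -> R) (x : R) :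
  (forall x, derivable h x 1) -> continuous (derive1 h) ->
  dilation_mean 0 (fun y => h y + y * derive1 h y) x = h x.
Proof.
move=> dh ch'.
have ch : continuous h := derivable1_continuous dh.
have ck : continuous (fun y => h y + y * derive1 h y).
  move=> y; apply: (@continuousD R R R h (fun y => y * derive1 h y) y (ch y)).
  by apply: continuousM => //; exact: ch'.
have d (u : R) : is_derive u 1 (fun u : R => u * h (u * x))
    (u ^+ 0 * (h (u * x) + u * x * derive1 h (u * x))).
  have := is_derive_dilation x u dh => /is_derive_mulx.
  by rewrite expr0 mul1r mulrA.
rewrite /dilation_mean (FTC01 d); last exact: (@continuous_dilation R 0 _ x ck).
by rewrite !mul1r mul0r subr0.
Qed.

(** * The means S^n and the operators A_n *)

Lemma opA_continuous (R : realType) (n : nat) (f : R -> R) :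
  Cn n.+1 f -> continuous (opA n.+1 f).
Proof.
move=> Cf; have /CnS[_] : Cn 1 (iter n (@opT R) f) by exact: Cn_iter_opT.
exact: Cn_continuous.
Qed.

(** A_(n+2) f = (x A_(n+1) f)', to which [dilation_mean_mulx] applies. *)
Lemma dilation_mean_opA (R : realType) (n : nat) (f : R -> R) :
  Cn n.+2 f -> dilation_mean 0 (opA n.+2 f) = opA n.+1 f.
Proof.
move=> Cf; have /CnS[_] : Cn 2 (iter n (@opT R) f) by exact: Cn_iter_opT.
rewrite -[derive1 _]/(opA n.+1 f); set h := opA n.+1 f => /CnS[dh /Cn_continuous ch].
have -> : opA n.+2 f = fun x => h x + x * derive1 h x.
  apply/funext => x; rewrite -[opA _ f]/(derive1 (fun x => x * h x)) derive1E.
  by have [_ ->] := is_derive_mulx (is_derive1_derive1 (dh x)).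
by apply/funext => x; rewrite dilation_mean_mulx.
Qed.

(** A_1 f = f', so the last of the n + 1 means is [dilation_mean_derive1] and the
    others step down from A_(n+1) f to A_1 f. *)
Lemma mulx_iter_dilation_mean_opA (R : realType) (n : nat) (f : R -> R) (x : R) :
  Cn n.+1 f ->
  x * iter n.+1 (@dilation_mean R 0) (opA n.+1 f) x = f x - f 0.
Proof.
elim: n => [/CnS[df /Cn_continuous cf]|n IH Cf]; first exact: dilation_mean_derive1.
by rewrite iterSr dilation_mean_opA// IH//; exact: CnW.
Qed.

(** * Bounded functions with bounded derivatives *)

(** The class C^n_b; the recursion on n matches the way derivatives pass through
    S. *)
Fixpoint Cnb (R : realType) (n : nat) (g : R -> R) : Prop :=
  [/\ continuous g, exists M, forall x, `|g x| <= M &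
   if n is m.+1 then (forall x, derivable g x 1) /\ Cnb m (derive1 g) else True].

Lemma CnbW (R : realType) (n : nat) (g : R -> R) : Cnb n.+1 g -> Cnb n g.
Proof.
elim: n g => [|n IH] g [cg bg [dg Cg]]; first by split.
by split=> //; split=> //; exact: IH.
Qed.

Lemma Cnb_Cn (R : realType) (n : nat) (g : R -> R) : Cnb n g -> Cn n g.
Proof.
elim: n g => [|n IH] g [cg _]; first by split.
by move=> [dg Cg]; apply/CnS; split=> //; exact: IH.
Qed.

Lemma Cnb_cst (R : realType) (n : nat) (c : R) : Cnb n (fun=> c).
Proof.
elim: n c => [|n IH] c; (split; [exact: cst_continuous|by exists (`|c|) |]) => //.
split=> [x|]; first exact: derivable_cst.
by rewrite (_ : derive1 _ = fun=> 0) //; apply/funext => x; rewrite derive1_cst.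
Qed.

Lemma CnbD (R : realType) (n : nat) (f g : R -> R) :
  Cnb n f -> Cnb n g -> Cnb n (fun x => f x + g x).
Proof.
elim: n f g => [|n IH] f g.
all: move=> [cf [M fM] Cf] [cg [N gN] Cg]; split.
all: try by move=> x; apply: (@continuousD R R R f g x); [exact: cf|exact: cg].
all: try by exists (M + N) => x; rewrite (le_trans (ler_normD _ _))// lerD.
  by [].
move: Cf Cg => [df Cf] [dg Cg]; split=> [x|]; first exact: derivableD.
rewrite (_ : derive1 _ = fun x => derive1 f x + derive1 g x); first exact: IH.
by apply/funext => x; rewrite !derive1E deriveD.
Qed.

Lemma CnbM (R : realType) (n : nat) (f g : R -> R) :
  Cnb n f -> Cnb n g -> Cnb n (fun x => f x * g x).
Proof.
elim: n f g => [|n IH] f g Cf0 Cg0.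
all: move: (Cf0) (Cg0) => [cf [M fM] Cf] [cg [N gN] Cg]; split.
all: try by move=> x; apply: (@continuousM R R f g x); [exact: cf|exact: cg].
all: try by exists (M * N) => x; rewrite normrM ler_pM.
  by [].
move: Cf Cg => [df Cf] [dg Cg]; split=> [x|]; first exact: derivableM.
rewrite (_ : derive1 _ = fun x => f x * derive1 g x + g x * derive1 f x).
  by apply: CnbD; apply: IH => //; exact: CnbW.
by apply/funext => x; rewrite !derive1E deriveM.
Qed.

Lemma Cnb_dilation_mean (R : realType) (n j : nat) (g : R -> R) :
  Cnb n g -> Cnb n (dilation_mean j g).
Proof.
elim: n j g => [|n IH] j g [cg [M gM] Cg].
  by split=> //; [exact: dilation_mean_continuous|exists M; exact: dilation_mean_bound].
split; [exact: dilation_mean_continuous|by exists M; exact: dilation_mean_bound|].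
have [dg Cg'] := Cg.
have [cg' [N g'N]] : continuous (derive1 g) /\ exists N, forall x, `|derive1 g x| <= N.
  by case: (n) Cg' => [|k] [].
have d := is_derive_dilation_mean j dg cg' g'N.
split=> [x|]; first by case: (d x).
rewrite (_ : derive1 _ = dilation_mean j.+1 (derive1 g)); first exact: IH.
by apply/funext => x; rewrite derive1E; have [_ ->] := d x.
Qed.

(** The derivative S g + x (S g)' is S (g + x g'), which is g by
    [dilation_mean_mulx]. *)
Lemma is_derive_mulx_dilation_mean (R : realType) (g : R -> R) (x : R) :
  Cnb 1 g -> is_derive x 1 (fun y => y * dilation_mean 0 g y) (g x).
Proof.
move=> [cg _ [dg [cg' [N g'N] _]]].
have d := is_derive_dilation_mean 0 dg cg' g'N x.
have c0 := @continuous_dilation R 0 g x cg.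
have c1 := @continuous_dilation R 1 _ x cg'.
rewrite -[X in is_derive _ _ _ X](dilation_mean_mulx x dg cg').
have -> : dilation_mean 0 (fun y => g y + y * derive1 g y) x =
    dilation_mean 0 g x + x * dilation_mean 1 (derive1 g) x.
  rewrite /dilation_mean -RintegralZl//; last exact: integrable01.
  rewrite -RintegralD//.
  - by apply: eq_Rintegral => u _; rewrite !expr0 !mul1r expr1 mulrCA mulrA.
  - exact: integrable01.
  - apply: (@integrable01 R (fun u : R => x * (u ^+ 1 * derive1 g (u * x)))) => u.
    apply: (@continuousM R R (cst x) (fun u => u ^+ 1 * derive1 g (u * x))).
      exact: cst_continuous.
    exact: c1.
exact: is_derive_mulx.
Qed.

Lemma Cnb_iter_dilation_mean (R : realType) (n k : nat) (g : R -> R) :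
  Cnb n g -> Cnb n (iter k (@dilation_mean R 0) g).
Proof. by move=> Cg; elim: k => //= k; exact: Cnb_dilation_mean. Qed.

Lemma derive1_mulx_iter (R : realType) (k : nat) (g : R -> R) : Cnb 1 g ->
  derive1 (fun x => x * iter k.+1 (@dilation_mean R 0) g x) =
  iter k (@dilation_mean R 0) g.
Proof.
move=> Cg; apply/funext => x; rewrite derive1E.
by have [_ ->] := is_derive_mulx_dilation_mean x (Cnb_iter_dilation_mean k Cg).
Qed.

(** Since (x S h)' = h, each application of T cancels one mean: T (x S h) = x h. *)
Lemma iter_opT_mulx_iter (R : realType) (k m : nat) (g : R -> R) : Cnb 1 g ->
  iter k (@opT R) (fun x => x * iter (m + k) (@dilation_mean R 0) g x) =
  fun x => x * iter m (@dilation_mean R 0) g x.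
Proof.
move=> Cg; elim: k => [|k IH]; first by rewrite addn0.
by rewrite iterSr addnS {2}/opT derive1_mulx_iter.
Qed.

Lemma opA_mulx_iter (R : realType) (n : nat) (g : R -> R) : Cnb 1 g ->
  opA n.+1 (fun x => x * iter n.+1 (@dilation_mean R 0) g x) = g.
Proof.
move=> Cg; rewrite /opA -[in LHS]add1n iter_opT_mulx_iter//.
exact: (derive1_mulx_iter 0).
Qed.

Lemma Cn_mulx_iter (R : realType) (n : nat) (g : R -> R) : Cnb n.+1 g ->
  Cn n.+1 (fun x => x * iter n.+1 (@dilation_mean R 0) g x).
Proof.
move=> Cg.
have Cg1 : Cnb 1 g by elim: n Cg => // n IH /CnbW.
apply/CnS; split=> [x|].
  by case: (is_derive_mulx_dilation_mean x (Cnb_iter_dilation_mean n Cg1)).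
rewrite derive1_mulx_iter//; apply: Cnb_Cn; apply: Cnb_iter_dilation_mean.
exact: CnbW.
Qed.

(** * Sigmoids *)

Definition sigmoid (R : realType) (a b x : R) : R := (1 + expR (- (a * x + b)))^-1.

Lemma sigmoid_ge0_le1 (R : realType) (a b x : R) : 0 <= sigmoid a b x <= 1.
Proof.
have e0 := expR_gt0 (- (a * x + b)).
have d0 : 0 < 1 + expR (- (a * x + b)) by rewrite addr_gt0.
by rewrite /sigmoid invr_ge0 (ltW d0) invf_le1// lerDl ltW.
Qed.

Lemma is_derive_sigmoid (R : realType) (a b x : R) :
  is_derive x 1 (sigmoid a b)
    (a * (sigmoid a b x + - 1 * (sigmoid a b x * sigmoid a b x))).
Proof.
have e0 := expR_gt0 (- (a * x + b)).
have daff : is_derive x 1 (fun y : R => - (a * y + b)) (- a).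
  by apply: is_derive_eq; rewrite /GRing.scale/=; ring.
have d1 : is_derive x 1 (fun y : R => 1 + expR (- (a * y + b)))
    (expR (- (a * x + b)) * - a).
  by apply: is_derive_eq; rewrite add0r mul1r.
have ne0 : 1 + expR (- (a * x + b)) != 0 by rewrite gt_eqF// addr_gt0.
have dV := @is_deriveV R (fun y : R => 1 + expR (- (a * y + b))) x _ 1 ne0 d1.
have -> : a * (sigmoid a b x + - 1 * (sigmoid a b x * sigmoid a b x)) =
   (- (1 + expR (- (a * x + b))) ^- 2) *: (expR (- (a * x + b)) * - a).
  by rewrite /sigmoid /GRing.scale/=; field.
exact: dV.
Qed.

(** The derivative of a sigmoid s is a multiple of s - s^2, which is of class
    C^n_b when s is; so s is then of class C^(n+1)_b. *)
Lemma Cnb_sigmoid (R : realType) (n : nat) (a b : R) : Cnb n (sigmoid a b).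
Proof.
have ds x : derivable (sigmoid a b) x 1 by case: (is_derive_sigmoid a b x).
have cs := derivable1_continuous ds.
have bs : exists M, forall x, `|sigmoid a b x| <= M.
  by exists 1 => x; have /andP[s0 s1] := sigmoid_ge0_le1 a b x; rewrite ger0_norm.
elim: n => [|n IH]; split=> //; split=> //.
have -> : derive1 (sigmoid a b) =
    fun x => a * (sigmoid a b x + - 1 * (sigmoid a b x * sigmoid a b x)).
  by apply/funext => x; rewrite derive1E; have [_ ->] := is_derive_sigmoid a b x.
apply: (CnbM (Cnb_cst n a)); apply: CnbD => //.
by apply: (CnbM (Cnb_cst n (-1))); exact: CnbM.
Qed.

(** * Change of density and multiplication by a uniform variable *)

Lemma exists_density_probability (R : realType) (d : measure_display)
    (T : measurableType d) (mu : {measure set T -> \bar R}) (D : T -> R) :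
  measurable_fun setT D -> (forall t, 0 <= D t) ->
  (\int[mu]_t (D t)%:E = 1)%E ->
  exists Q : probability T R,
    forall A, measurable A -> (Q A = \int[mu]_(t in A) (D t)%:E)%E.
Proof.
move=> mD D0 D1; pose Q A := (\int[mu]_(t in A) (D t)%:E)%E.
have DE0 t : (0 <= (D t)%:E)%E by rewrite lee_fin.
have Q0 : Q set0 = 0%E by rewrite /Q integral_set0.
have Qge0 A : (0 <= Q A)%E by apply: integral_ge0.
have Qs : semi_sigma_additive Q.
  by apply: semi_sigma_additive_nng_induced => //; exact/measurable_EFinP.
pose QM := isMeasure.Build d T R Q Q0 Qge0 Qs.
pose Qm : {measure set T -> \bar R} := HB.pack Q QM.
have Q1 : Qm setT = 1%E by [].
pose QP := Measure_isProbability.Build d T R Qm Q1.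
pose Qp : probability T R := HB.pack (Measure.sort Qm) QP.
by exists Qp.
Qed.

(** D is a Radon-Nikodym derivative of Q, and such derivatives are unique almost
    everywhere. *)
Lemma integral_density (R : realType) (d : measure_display)
    (T : measurableType d) (mu : {sigma_finite_measure set T -> \bar R})
    (Q : probability T R) (D : T -> R) (f : T -> \bar R) :
  measurable_fun setT D -> (forall t, 0 <= D t) ->
  (forall A, measurable A -> (Q A = \int[mu]_(t in A) (D t)%:E)%E) ->
  Q.-integrable setT f ->
  (\int[Q]_t f t = \int[mu]_t (f t * (D t)%:E))%E.
Proof.
move=> mD D0 QD intf.
have mDE : measurable_fun setT (EFin \o D) by exact/measurable_EFinP.
have intD : mu.-integrable setT (EFin \o D).
  apply/integrableP; split=> //.
  under eq_integral do rewrite gee0_abs ?lee_fin//.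
  by rewrite -QD// probability_setT ltry.
have Qmu : Q `<< mu.
  apply/null_content_dominatesP => A mA muA0; rewrite QD//.
  by rewrite null_set_integral//; exact: measurable_funTS.
rewrite -(Radon_Nikodym_change_of_variables Qmu)//.
have mf := measurable_int _ intf.
apply: ae_eq_integral => //.
- apply: emeasurable_funM => //; apply: (measurable_int mu).
- exact: emeasurable_funM.
apply: ae_eqe_mul2l; rewrite Radon_NikodymE//=.
case: cid => /= h [h1 h2 h3].
apply: integral_ae_eq => //=.
by move=> A _ mA; rewrite -h3//= QD.
Qed.

Lemma uniform01_integral (R : realType) (f : R -> \bar R) :
  measurable_fun setT f ->
  (\int[uniform_prob (@ltr01 R)]_u f u = \int[leb]_(u in `[0%R, 1%R]) f u)%E.
Proof.
move=> mf; rewrite integralE [RHS]integralE.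
rewrite !integral_uniform//; [|exact: measurable_funeneg|exact: measurable_funepos].
by rewrite subr0 invr1 !mul1e.
Qed.

(** On the product of the probability space of Y with [0, 1], the variable
    Y' (t, u) = u Y t integrates g to the mean of S g over Y, by Fubini. *)
Lemma exists_uniform_dilation (R : realType) (d : measure_display)
    (T : measurableType d) (Q : probability T R) (Y : {RV Q >-> R}) :
  exists (d' : measure_display) (T' : measurableType d')
      (Q' : probability T' R) (Y' : {RV Q' >-> R}),
    forall g : R -> R, continuous g ->
      Q'.-integrable setT (EFin \o (g \o Y')) ->
      Q.-integrable setT (EFin \o (dilation_mean 0 g \o Y)) /\
      (\int[Q']_t (g (Y' t))%:E = \int[Q]_t (dilation_mean 0 g (Y t))%:E)%E.
Proof.
pose U := uniform_prob (@ltr01 R).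
pose Q' : probability (T * measurableTypeR R)%type R := (Q \x U)%E.
pose y (z : T * measurableTypeR R) : R := z.2 * Y z.1.
have my : measurable_fun setT y.
  apply: (@measurable_funM _ _ _ setT (fun z => z.2) (fun z => Y z.1)).
    exact: measurable_snd.
  exact: measurableT_comp.
pose Y' : {RV Q' >-> R} := mfun_Sub (mem_set my).
exists _, _, Q', Y' => g cg intg.
have mg : measurable_fun setT g := continuous_measurable_fun cg.
have FE t : fubini_F U (EFin \o (g \o y)) t = (dilation_mean 0 g (Y t))%:E.
  rewrite /fubini_F uniform01_integral; last first.
    apply/measurable_EFinP; apply: (@continuous_measurable_fun R (fun u => g (u * Y t))).
    by move=> u; apply: continuous_comp; [exact: mulrr_continuous|exact: cg].
  rewrite /dilation_mean /Rintegral fineK; last first.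
    have := @integrable01 R _ (continuous_dilation (j := 0) (x := Y t) cg).
    by move=> /(integrable_fin_num _); exact.
  by apply: eq_integral => u _; rewrite expr0 mul1r.
have -> : (EFin \o (dilation_mean 0 g \o Y)) = fubini_F U (EFin \o (g \o y)).
  by apply/funext => t; rewrite FE.
split; first exact: integrable_fubini_F.
transitivity (\int[Q]_t fubini_F U (EFin \o (g \o y)) t)%E; last exact: eq_integral.
by rewrite integral12_prod_meas1.
Qed.

Lemma exists_iter_uniform_dilation (R : realType) (n : nat) (d : measure_display)
    (T : measurableType d) (Q : probability T R) (Y : {RV Q >-> R}) :
  exists (d' : measure_display) (T' : measurableType d')
      (Q' : probability T' R) (Y' : {RV Q' >-> R}),
    forall g : R -> R, continuous g ->
      Q'.-integrable setT (EFin \o (g \o Y')) ->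
      Q.-integrable setT (EFin \o (iter n (@dilation_mean R 0) g \o Y)) /\
      (\int[Q']_t (g (Y' t))%:E = \int[Q]_t (iter n (@dilation_mean R 0) g (Y t))%:E)%E.
Proof.
elim: n => [|n [d1 [T1 [Q1 [Y1 IH]]]]]; first by exists d, T, Q, Y.
have [d2 [T2 [Q2 [Y2 H]]]] := exists_uniform_dilation Y1.
exists d2, T2, Q2, Y2 => g cg /(H _ cg)[int1 ->]; rewrite iterSr.
by apply: IH => //; exact: dilation_mean_continuous.
Qed.

(** * Laws are determined by smooth bounded functions *)

(** The sigmoid has argument k^2 (x - a) - k.  The shift by k sends it to 0 also at
    x = a, where a centred sigmoid would stay at 1/2, and k^2 outweighs k when
    x > a. *)
Lemma sigmoid_cvg_indic (R : realType) (a x : R) :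
  sigmoid (k%:R ^+ 2) (- (k%:R ^+ 2 * a) - k%:R) x @[k --> \oo] -->
  (\1_(`]a, +oo[%classic : set R) x : R).
Proof.
(* Both tails are compared with the harmonic sequence through 1 + y <= expR y. *)
have expN (y : R) (k : nat) : k%:R <= y -> expR (- y) <= harmonic k.
  move=> ky; rewrite /= expRN lef_pV2 ?posrE ?expR_gt0//.
  by rewrite -natr1 addrC (le_trans _ (expR_ge1Dx y))// lerD2l.
apply/subr_cvg0; apply: norm_cvg0.
apply: (@squeeze_cvgr _ _ _ _ (cst 0) harmonic); last exact: cvg_harmonic.
  2: exact: cvg_cst.
near=> k; rewrite normr_ge0/=.
set y := k%:R ^+ 2 * (x - a) - k%:R.
have -> : sigmoid (k%:R ^+ 2) (- (k%:R ^+ 2 * a) - k%:R) x = (1 + expR (- y))^-1.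
  by rewrite /sigmoid /y; congr (1 + expR (- _))^-1; ring.
have e0 := expR_gt0 (- y).
have e1 : 0 < 1 + expR (- y) by rewrite addr_gt0.
rewrite indicE mem_setE in_itv/= andbT.
have [ax|xa] := ltP a x.
  have yk : k%:R <= y.
    have d0 : 0 < x - a by rewrite subr_gt0.
    (* From here on, k (x - a) >= 2 and so k^2 (x - a) - k >= k. *)
    have : 2 / (x - a) <= k%:R by near: k; exact: nbhs_infty_ger.
    rewrite ler_pdivrMr// => k2.
    rewrite /y expr2 -mulrA -{4}[k%:R]mulr1 -mulrBr -{1}[k%:R]mulr1.
    by rewrite ler_wpM2l// lerBrDr.
  apply: (le_trans _ (expN _ _ yk)).
  rewrite distrC (_ : 1 - _ = expR (- y) / (1 + expR (- y))).
    rewrite ger0_norm; last by rewrite divr_ge0// ltW.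
    by rewrite ler_pdivrMr// mulrDr mulr1 lerDl mulr_ge0// ltW.
  by field; rewrite gt_eqF.
rewrite subr0 ger0_norm; last by rewrite invr_ge0 ltW.
rewrite /= lef_pV2 ?posrE//.
rewrite -natr1 addrC lerD2l.
have y0 : k%:R <= - y.
  by rewrite /y opprB lerDl oppr_ge0 mulr_ge0_le0// subr_le0.
by apply: (le_trans y0); apply: le_trans (expR_ge1Dx _); rewrite lerDr.
Unshelve. all: by end_near. Qed.

Lemma measurable_sigmoid (R : realType) (a b : R) : measurable_fun setT (sigmoid a b).
Proof. by apply: continuous_measurable_fun; case: (Cnb_sigmoid 0 a b). Qed.

Lemma sigmoid_integral_cvg (R : realType) (d : measure_display)
    (T : measurableType d) (P : probability T R) (X : {RV P >-> R}) (a : R) :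
  (\int[P]_t (sigmoid (k%:R ^+ 2) (- (k%:R ^+ 2 * a) - k%:R) (X t))%:E)%E
    @[k --> \oo] --> distribution P X `]a, +oo[%classic.
Proof.
have mA : measurable (X @^-1` `]a, +oo[%classic).
  by rewrite -[X in measurable X]setTI; exact: measurable_funPT.
have -> : distribution P X `]a, +oo[%classic =
    (\int[P]_t (\1_(X @^-1` `]a, +oo[%classic) t)%:E)%E.
  by rewrite integral_indic// setIT.
apply: (@dominated_cvg _ _ _ P setT measurableT _ _ (cst 1%E)) => //.
- move=> k; apply/measurable_EFinP; apply: measurableT_comp => //.
  exact: measurable_sigmoid.
- move=> t _; apply: cvg_EFin; first exact: nearW.
  exact: (@sigmoid_cvg_indic R a (X t)).
- exact: finite_measure_integrable_cst.
- move=> k t _.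
  have /andP[s0 s1] := sigmoid_ge0_le1 (k%:R ^+ 2) (- (k%:R ^+ 2 * a) - k%:R) (X t).
  by rewrite abse_EFin lee_fin ger0_norm.
Qed.

(** The limits of sigmoids settle the half-lines, which are stable under
    intersection and generate the Borel sets. *)
Lemma eq_distribution (R : realType)
    (d d' : measure_display) (T : measurableType d) (T' : measurableType d')
    (P : probability T R) (P' : probability T' R)
    (X : {RV P >-> R}) (X' : {RV P' >-> R}) :
  (forall g, (forall n, Cnb n g) ->
    (\int[P]_t (g (X t))%:E = \int[P']_t (g (X' t))%:E)%E) ->
  forall B : set R, measurable B -> distribution P X B = distribution P' X' B.
Proof.
move=> H B mB.
apply: (@measure_unique default_measure_display R R (@RGenOInfty.G R)
  (fun k => `](- k%:R), +oo[%classic)) => //.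
- exact: RGenOInfty.measurableE.
- move=> _ _ [x ->] [y ->]; exists (Num.max x y); rewrite predeqE => z /=.
  rewrite !in_itv/= !andbT gt_max; split=> [[-> ->]//|/andP//].
- by move=> k; exists (- k%:R).
- rewrite -subTset => x _.
  have [k xk] : exists k : nat, - x < k%:R.
    by near \oo => k; exists k; near: k; exact: nbhs_infty_gtr.
  by exists k => //=; rewrite in_itv/= andbT ltrNl.
- move=> _ [a ->].
  apply: (cvg_unique _ (@sigmoid_integral_cvg _ _ _ _ X a)) => //.
  have Hk k : (\int[P]_t (sigmoid (k%:R ^+ 2) (- (k%:R ^+ 2 * a) - k%:R) (X t))%:E =
      \int[P']_t (sigmoid (k%:R ^+ 2) (- (k%:R ^+ 2 * a) - k%:R) (X' t))%:E)%E.
    by apply: H => n; exact: Cnb_sigmoid.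
  by rewrite (funext Hk); exact: sigmoid_integral_cvg.
- by move=> k; rewrite (le_lt_trans (probability_le1 _ _))// ltry.
Unshelve. all: by end_near. Qed.

(** * The zero bias distribution *)

Lemma centered_second_moment (R : realType) (d : measure_display)
    (T : measurableType d) (P : probability T R) (W : {RV P >-> R}) (sigma : R) :
  ('E_P[W] = 0)%E -> ('V_P[W] = (sigma ^+ 2)%:E)%E ->
  (\int[P]_t (W t ^+ 2)%:E = (sigma ^+ 2)%:E)%E.
Proof.
move=> EW; rewrite /variance covariance.unlock EW expectation.unlock => <-.
by apply: eq_integral => t _ /=; rewrite !fctE/= subr0 expr2.
Qed.

Lemma integrable_sqr (R : realType) (d : measure_display)
    (T : measurableType d) (P : probability T R) (W : {RV P >-> R}) (c : R) :
  (\int[P]_t (W t ^+ 2)%:E = c%:E)%E ->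
  P.-integrable setT (EFin \o (fun t => W t ^+ 2)).
Proof.
move=> W2; apply/integrableP; split.
  by apply/measurable_EFinP; exact: measurable_funX.
under eq_integral do rewrite gee0_abs ?lee_fin ?sqr_ge0//.
by rewrite W2 ltry.
Qed.

Lemma integrable_of_sqr (R : realType) (d : measure_display)
    (T : measurableType d) (P : probability T R) (W : {RV P >-> R}) :
  P.-integrable setT (EFin \o (fun t => W t ^+ 2)) ->
  P.-integrable setT (EFin \o W).
Proof.
move=> iW2.
have i1 : P.-integrable setT (EFin \o (cst (1 : R) : T -> R)).
  exact: finite_measure_integrable_cst.
apply: le_integrable (integrableD measurableT i1 iW2) => //.
  exact/measurable_EFinP.
move=> t _; rewrite -[leRHS]/(`|(1 + W t ^+ 2)%:E|)%E !abse_EFin lee_fin.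
rewrite [leRHS]ger0_norm ?addr_ge0 ?sqr_ge0//.
by rewrite -(real_normK (num_real (W t))); have := sqr_ge0 (`|W t| - 1); nra.
Qed.

(** The total mass of the density W^2 / sigma^2 is 1 because W has second moment
    sigma^2. *)
Lemma exists_square_bias (R : realType) (d : measure_display)
    (T : measurableType d) (P : probability T R) (W : {RV P >-> R}) (sigma : R) :
  0 < sigma -> (\int[P]_t (W t ^+ 2)%:E = (sigma ^+ 2)%:E)%E ->
  exists Q : probability T R, forall h : T -> R,
    Q.-integrable setT (EFin \o h) ->
    (\int[Q]_t (h t)%:E = \int[P]_t (h t * (W t ^+ 2 / sigma ^+ 2))%:E)%E.
Proof.
move=> s0 W2; pose D t := W t ^+ 2 / sigma ^+ 2.
have mD : measurable_fun setT D.
  by apply: measurable_funM => //; exact: measurable_funX.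
have D0 t : 0 <= D t by rewrite divr_ge0 ?sqr_ge0.
have D1 : (\int[P]_t (D t)%:E = 1)%E.
  under eq_integral do rewrite /D mulrC EFinM.
  rewrite integralZl//; last exact: integrable_sqr W2.
  by rewrite W2 -EFinM mulVf// expf_neq0// gt_eqF.
have [Q QD] := exists_density_probability mD D0 D1.
exists Q => h ih.
exact: (@integral_density _ _ _ P Q D (EFin \o h)).
Qed.

(** Since x S^(n+1) (A_(n+1) f) = f - f 0, the density W^2 / sigma^2 turns the
    mean of A_(n+1) f under W' into that of W (f W - f 0) / sigma^2. *)
Lemma exists_zero_bias (R : realType) (n : nat) (d : measure_display)
    (T : measurableType d) (P : probability T R) (W : {RV P >-> R}) (sigma : R) :
  0 < sigma -> ('E_P[W] = 0)%E -> ('V_P[W] = (sigma ^+ 2)%:E)%E ->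
  exists (d' : measure_display) (T' : measurableType d')
      (P' : probability T' R) (W' : {RV P' >-> R}), zero_bias n.+1 sigma W W'.
Proof.
move=> s0 EW VW; have W2 := centered_second_moment EW VW.
have iW := integrable_of_sqr (integrable_sqr W2).
have s2 : sigma ^+ 2 != 0 by rewrite expf_neq0// gt_eqF.
have [Q HQ] := exists_square_bias s0 W2.
pose WQ : {RV Q >-> R} := mfun_Sub (mem_set (measurable_funPT W)).
have [d' [T' [P' [W' H]]]] := exists_iter_uniform_dilation n.+1 WQ.
exists d', T', P', W' => f Cf int1 int2.
have [intQ EQ] := H _ (opA_continuous Cf) int2.
move: EW; rewrite !expectation.unlock => EW.
have iD : P.-integrable setT
    (fun t => (W t * f (W t))%:E - (f 0)%:E * (W t)%:E)%E.
  by apply: integrableB => //; exact: integrableZl.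
rewrite EQ HQ//.
transitivity (\int[P]_t ((W t * f (W t))%:E - (f 0)%:E * (W t)%:E))%E.
  rewrite integralB//; last exact: integrableZl.
  by rewrite integralZl// EW mule0 sube0.
transitivity ((sigma ^+ 2)%:E * \int[P]_t ((sigma ^- 2)%:E *
    ((W t * f (W t))%:E - (f 0)%:E * (W t)%:E)))%E.
  by rewrite [in RHS]integralZl// muleA -EFinM mulfV// mul1e.
congr (_ * _)%E; apply: eq_integral => t _.
rewrite -!EFinM; congr _%:E.
have -> : W t * f (W t) - f 0 * W t = W t * (f (W t) - f 0) by ring.
by rewrite -(mulx_iter_dilation_mean_opA (W t) Cf) /=; field; rewrite gt_eqF.
Qed.

(** The test function x S^(n+1) g is admissible and A_(n+1) maps it to g, so the
    left-hand side, which only involves W, determines the mean of g (W'). *)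
Lemma zero_bias_forces_mean (R : realType) (n : nat) (d : measure_display)
    (T : measurableType d) (P : probability T R) (W : {RV P >-> R}) (sigma : R)
    (d' : measure_display) (T' : measurableType d') (P' : probability T' R)
    (W' : {RV P' >-> R}) (g : R -> R) :
  P.-integrable setT (EFin \o (fun t => W t ^+ 2)) -> Cnb n.+1 g ->
  zero_bias n.+1 sigma W W' ->
  (\int[P]_t (W t * (W t * iter n.+1 (@dilation_mean R 0) g (W t)))%:E =
   (sigma ^+ 2)%:E * \int[P']_t (g (W' t))%:E)%E.
Proof.
move=> iW2 Cg zb.
have Cg1 : Cnb 1 g by elim: n Cg {zb} => // n IH /CnbW.
have [ck [M kM] _] := Cnb_iter_dilation_mean n.+1 Cg; set k := iter _ _ _ in ck kM *.
have mk : measurable_fun setT k := continuous_measurable_fun ck.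
have [cg [N gN] _] := Cg.
have mg : measurable_fun setT g := continuous_measurable_fun cg.
have := zb _ (Cn_mulx_iter Cg); rewrite opA_mulx_iter// !expectation.unlock; apply.
- apply: le_integrable (integrableZl measurableT M iW2) => //.
    apply/measurable_EFinP; apply: measurable_funM => //; apply: measurable_funM => //.
    exact: measurableT_comp.
  move=> t _; rewrite -[leRHS]/(`|(M * W t ^+ 2)%:E|)%E /= -/(k _).
  rewrite lee_fin mulrA -expr2 mulrC !normrM.
  by rewrite ler_wpM2r//; apply: le_trans (ler_norm _).
- apply: le_integrable (finite_measure_integrable_cst P' N measurableT) => //.
    by apply/measurable_EFinP; exact: measurableT_comp.
  by move=> t _; rewrite /= lee_fin; apply: le_trans (ler_norm _).
Qed.
Theorem lemma2p2 (R : realType) (n : nat) (n_ge1 : (1 <= n)%N)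
    (d : measure_display) (T : measurableType d) (P : probability T R)
    (W : {RV P >-> R}) (sigma : R) (sigma_gt0 : 0 < sigma)
    (meanW : ('E_P[W] = 0)%E) (varW : ('V_P[W] = (sigma ^+ 2)%:E)%E) :
  exists (d' : measure_display) (T' : measurableType d')
      (P' : probability T' R) (W' : {RV P' >-> R}),
    zero_bias n sigma W W' /\
    forall (d'' : measure_display) (T'' : measurableType d'')
        (P'' : probability T'' R) (W'' : {RV P'' >-> R}),
      zero_bias n sigma W W'' ->
      forall B : set R, measurable B ->
        distribution P'' W'' B = distribution P' W' B.

Proof.
case: n n_ge1 => // n _.
have W2 := integrable_sqr (centered_second_moment meanW varW).
have [d' [T' [P' [W' zb]]]] := exists_zero_bias n sigma_gt0 meanW varW.
exists d', T', P', W'; split=> // d'' T'' P'' W'' zb'' B mB.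
apply: eq_distribution mB => g Cg.
have s2 : sigma ^+ 2 != 0 by rewrite expf_neq0// gt_eqF.
have := zero_bias_forces_mean W2 (Cg n.+1) zb''.
rewrite (zero_bias_forces_mean W2 (Cg n.+1) zb) => E.
have : ((sigma ^- 2)%:E * ((sigma ^+ 2)%:E * \int[P'']_t (g (W'' t))%:E) =
  (sigma ^- 2)%:E * ((sigma ^+ 2)%:E * \int[P']_t (g (W' t))%:E))%E by rewrite E.
by rewrite !muleA -EFinM mulVf// !mul1e.
Qed.
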